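(* Let $((\beta_{x,y}),\{\widetilde{\tau}_x\},\{\widetilde{\omega}_y\},0)$ be an MDI-EW such that $\beta_{x,y}\neq 0$ for all $x$ and $y$. Then this MDI-EW is sensitive.
   Context: $H_A,H_B$ are finite-dimensional complex Hilbert spaces. A state is a density operator (positive semidefinite, trace one). A POVM operator is a Hermitian operator $E$ with $0\le E\le I$. $T$ denotes transposition in a fixed orthonormal basis. Entanglement witness (weakly optimal): a Hermitian operator $\widetilde W$ on $H_A\otimes H_B$ such that $\min_{\sigma}\mathrm{Tr}(\widetilde W\sigma)=0$, the minimum being over all separable states $\sigma$ on $H_A\otimes H_B$, and $\mathrm{Tr}(\widetilde W\rho)<0$ for some entangled state $\rho$. MDI-EW: a tuple $((\beta_{x,y}),\{\widetilde\tau_x\},\{\widetilde\omega_y\},0)$ consisting of a nonzero real matrix $(\beta_{x,y})$ (finite index sets for $x$ and $y$), pure states $\widetilde\tau_x$ on $H_A$ and pure states $\widetilde\omega_y$ on $H_B$ (rank-one projections), such that the operator $\widetilde W=\sum_{x,y}\beta_{x,y}\widetilde\tau_x^T\otimes\widetilde\omega_y^T$ is a weakly optimal entanglement witness, i.e. $\min_{\sigma}\mathrm{Tr}(\widetilde W\sigma)=0$ over all separable states $\sigma$ on $H_A\otimes H_B$ and $\mathrm{Tr}(\widetilde W\rho)<0$ for some entangled state $\rho$. Sensitive: an MDI-EW $((\beta_{x,y}),\{\widetilde\tau_x\},\{\widetilde\omega_y\},0)$ is sensitive if for every $0<\epsilon\le 1$ there exist states $\tau_x$ on $H_A$ and $\omega_y$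 on $H_B$ with $\mathrm{Tr}(\tau_x\widetilde\tau_x)\ge 1-\epsilon$ and $\mathrm{Tr}(\omega_y\widetilde\omega_y)\ge 1-\epsilon$ for all $x,y$, and POVM operators $A$ on $H_A$ and $B$ on $H_B$, such that $\sum_{x,y}\beta_{x,y}\mathrm{Tr}(A\tau_x)\mathrm{Tr}(B\omega_y)<0$. *)

(* Defs.v *)
(* MathComp, over the complex numbers R[i] of a realType R. *)
From HB Require Import structures.
From mathcomp Require Import all_boot all_order all_algebra.
From mathcomp Require Export complex.
From mathcomp Require Import mxtens.
From mathcomp Require Export reals.

Set Implicit Arguments.
Unset Strict Implicit.
Unset Printing Implicit Defensive.

Import Order.TTheory GRing.Theory Num.Theory.

Local Open Scope ring_scope.
Local Open Scope complex_scope.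

(* A d-dimensional complex Hilbert space is C^d, with operators 'M[R[i]]_d, and
   C^m (x) C^n is C^(m * n) through the Kronecker product *t. The order on R[i]
   is the partial one: x <= y means that y - x is real and nonnegative. *)

Definition psdmx (R : realType) (d : nat) (M : 'M[R[i]]_d) : Prop :=
  M \is hermsymmx /\
  forall v : 'cV[R[i]]_d, 0 <= (map_mx Num.conj v^T *m M *m v) 0 0.

Definition is_state (R : realType) (d : nat) (rho : 'M[R[i]]_d) : Prop :=
  psdmx rho /\ \tr rho = 1.

Definition is_pure_state (R : realType) (d : nat) (rho : 'M[R[i]]_d) : Prop :=
  [/\ rho \is hermsymmx, rho *m rho = rho & \rank rho = 1%N].

Definition is_povm_op (R : realType) (d : nat) (E : 'M[R[i]]_d) : Prop :=
  psdmx E /\ psdmx (1%:M - E).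

Definition is_separable (R : realType) (m n : nat)
    (sigma : 'M[R[i]]_(m * n)) : Prop :=
  exists (k : nat) (p : 'I_k -> R)
         (rhoA : 'I_k -> 'M[R[i]]_m) (rhoB : 'I_k -> 'M[R[i]]_n),
    [/\ forall j, 0 <= p j, \sum_j p j = 1,
        forall j, is_state (rhoA j), forall j, is_state (rhoB j)
      & sigma = \sum_j (p j)%:C *: (rhoA j *t rhoB j)].

Definition is_entangled (R : realType) (m n : nat)
    (rho : 'M[R[i]]_(m * n)) : Prop :=
  is_state rho /\ ~ is_separable rho.

(* The second and third clauses say that the minimum of Tr (W sigma) over
   separable states sigma exists and equals 0. *)
Definition weakly_optimal_ew (R : realType) (m n : nat)
    (W : 'M[R[i]]_(m * n)) : Prop :=
  [/\ W \is hermsymmx,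
      exists2 sigma : 'M[R[i]]_(m * n), is_separable sigma & \tr (W *m sigma) = 0,
      forall sigma : 'M[R[i]]_(m * n), is_separable sigma -> 0 <= \tr (W *m sigma)
    & exists2 rho : 'M[R[i]]_(m * n), is_entangled rho & \tr (W *m rho) < 0].

Definition mdi_operator (R : realType) (X Y : finType) (m n : nat)
    (beta : X -> Y -> R) (tau : X -> 'M[R[i]]_m) (omega : Y -> 'M[R[i]]_n) :
    'M[R[i]]_(m * n) :=
  \sum_x \sum_y (beta x y)%:C *: ((tau x)^T *t (omega y)^T).

(* The last entry 0 of the tuple (beta, tau, omega, 0) is constant, so it is
   not an argument. *)
Definition is_mdi_ew (R : realType) (X Y : finType) (m n : nat)
    (beta : X -> Y -> R) (tau : X -> 'M[R[i]]_m) (omega : Y -> 'M[R[i]]_n) :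
    Prop :=
  [/\ exists x y, beta x y != 0,
      forall x, is_pure_state (tau x),
      forall y, is_pure_state (omega y)
    & weakly_optimal_ew (mdi_operator beta tau omega)].

(* Here tau0 and omega0 are the ideal inputs, tau and omega the actual ones. *)
Definition sensitive (R : realType) (X Y : finType) (m n : nat)
    (beta : X -> Y -> R) (tau0 : X -> 'M[R[i]]_m) (omega0 : Y -> 'M[R[i]]_n) :
    Prop :=
  forall eps : R, 0 < eps <= 1 ->
  exists (tau : X -> 'M[R[i]]_m) (omega : Y -> 'M[R[i]]_n)
         (A : 'M[R[i]]_m) (B : 'M[R[i]]_n),
    [/\ forall x, is_state (tau x) /\ (1 - eps)%:C <= \tr (tau x *m tau0 x),
        forall y, is_state (omega y) /\ (1 - eps)%:C <= \tr (omega y *m omega0 y),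
        is_povm_op A, is_povm_op B
      & \sum_x \sum_y
          (beta x y)%:C * \tr (A *m tau x) * \tr (B *m omega y) < 0].

(* Main.v *)
(** Let [a (x) b] be the complex conjugate of a product vector on which the
    witness vanishes (the witness carries transposes), and measure
    [A = |a><a|], [B = |b><b|], so that [sum beta x y * f x * g y = 0] with
    [f x = Tr (A tau x)] and [g y = Tr (B omega y)].  Mixing a vector orthogonal
    to [a] (resp. [b]) into an input shrinks the corresponding [f x] (resp.
    [g y]) by the factor [1 - eps].  If neither [f] nor [g] vanishes
    identically, the matrix [beta x y * f x * g y] is nonzero since no
    [beta x y] is zero, and a suitable shrinking of its rows and columns makes
    its sum negative.  If [f = 0], then only the inputs that are mixed with [a]
    contribute; as the witness is not positive, some
    [sum_y beta x y * omega y] has a vector of negative expectation, which is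
    taken for [B].  The case [g = 0] is symmetric. *)
Require Import Defs.
From mathcomp Require Import all_boot all_order all_algebra.
From mathcomp Require Import boolp mxtens ring.

Set Implicit Arguments.
Unset Strict Implicit.
Unset Printing Implicit Defensive.

Import Order.TTheory GRing.Theory Num.Theory.

Local Open Scope sesquilinear_scope.
Local Open Scope ring_scope.
Local Open Scope complex_scope.

(** * Positive semidefinite matrices, rank-one operators and tensor products *)

Section PositiveMatrices.
Context {R : realType}.
Local Notation C := R[i].

Definition ketbra d (v : 'cV[C]_d) : 'M[C]_d := v *m v^t*.

Definition qform d (M : 'M[C]_d) (v : 'cV[C]_d) : C := (v^t* *m M *m v) 0 0.

Lemma adjmxM d e f (A : 'M[C]_(d, e)) (B : 'M[C]_(e, f)) :
  (A *m B)^t* = B^t* *m A^t*.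
Proof. by rewrite trmx_mul map_mxM. Qed.

Lemma adjmxE d e (A : 'M[C]_(d, e)) i j : A^t* i j = Num.conj (A j i).
Proof. by rewrite !mxE. Qed.

Lemma adjmxD d e (A B : 'M[C]_(d, e)) : (A + B)^t* = A^t* + B^t*.
Proof. by apply/matrixP => i j; rewrite !mxE rmorphD. Qed.

Lemma adjmxZ d e (c : C) (A : 'M[C]_(d, e)) : (c *: A)^t* = Num.conj c *: A^t*.
Proof. by apply/matrixP => i j; rewrite !mxE rmorphM. Qed.

Lemma hermsymmxP d (M : 'M[C]_d) : reflect (M = M^t*) (M \is hermsymmx).
Proof. by rewrite is_hermitianmxE expr0 scale1r; apply: eqP. Qed.

Lemma sqnorm_ge0 d (v : 'cV[C]_d) : 0 <= (v^t* *m v) 0 0.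
Proof.
rewrite mxE sumr_ge0 // => i _.
by rewrite adjmxE mulrC mul_conjC_ge0.
Qed.

Lemma sqnorm_eq0 d (v : 'cV[C]_d) : (v^t* *m v) 0 0 = 0 -> v = 0.
Proof.
rewrite mxE => /eqP; rewrite psumr_eq0; last first.
  by move=> i _; rewrite adjmxE mulrC mul_conjC_ge0.
move=> /allP h; apply/matrixP => i j; rewrite ord1 mxE.
have := h i (mem_index_enum _).
by rewrite adjmxE mulrC mul_conjC_eq0 => /eqP.
Qed.

Lemma sqnorm_gt0 d (v : 'cV[C]_d) : v != 0 -> 0 < (v^t* *m v) 0 0.
Proof.
move=> v0; rewrite lt0r sqnorm_ge0 andbT.
by apply: contraNneq v0 => /sqnorm_eq0 ->.
Qed.

Lemma unit_scaling d (v : 'cV[C]_d) : v != 0 ->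
  exists2 c : C, 0 < c & ((c *: v)^t* *m (c *: v)) 0 0 = 1.
Proof.
move=> v0; have vv := sqnorm_gt0 v0; set s := (_ 0 0) in vv.
have sp : 0 < sqrtC s by rewrite sqrtC_gt0.
exists (sqrtC s)^-1; first by rewrite invr_gt0.
rewrite adjmxZ -scalemxAl -scalemxAr scalerA mxE -/s.
have -> : Num.conj (sqrtC s)^-1 = (sqrtC s)^-1.
  by apply: conj_Creal; rewrite realE invr_ge0 ltW.
by rewrite -invfM -expr2 sqrtCK mulVf // gt_eqF.
Qed.

Lemma tr_mul_ketbra d (M : 'M[C]_d) v : \tr (M *m ketbra v) = qform M v.
Proof. by rewrite mulmxA mxtrace_mulC mulmxA trace_mx11. Qed.

Lemma tr_ketbra_mul d (M : 'M[C]_d) v : \tr (ketbra v *m M) = qform M v.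
Proof. by rewrite mxtrace_mulC tr_mul_ketbra. Qed.

Lemma psdmx_gram d e (N : 'M[C]_(d, e)) : psdmx (N *m N^t*).
Proof.
split; first by apply/hermsymmxP; rewrite adjmxM trmxCK.
move=> v; have := sqnorm_ge0 (N^t* *m v).
by rewrite adjmxM trmxCK !mulmxA.
Qed.

Lemma psdmx_ketbra d (v : 'cV[C]_d) : psdmx (ketbra v).
Proof. exact: psdmx_gram. Qed.

Lemma hermsymmxD d (M N : 'M[C]_d) :
  M \is hermsymmx -> N \is hermsymmx -> M + N \is hermsymmx.
Proof.
move=> /hermsymmxP hM /hermsymmxP hN; apply/hermsymmxP.
by rewrite adjmxD -hM -hN.
Qed.

Lemma hermsymmxZ d (c : C) (M : 'M[C]_d) :
  c \is Num.real -> M \is hermsymmx -> c *: M \is hermsymmx.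
Proof.
move=> /conj_Creal hc /hermsymmxP hM; apply/hermsymmxP.
by rewrite adjmxZ -hM hc.
Qed.

Lemma qformD d (M N : 'M[C]_d) v : qform (M + N) v = qform M v + qform N v.
Proof. by rewrite /qform mulmxDr mulmxDl mxE. Qed.

Lemma qformZ d c (M : 'M[C]_d) v : qform (c *: M) v = c * qform M v.
Proof. by rewrite /qform -scalemxAr -scalemxAl mxE. Qed.

Lemma psdmxD d (M N : 'M[C]_d) : psdmx M -> psdmx N -> psdmx (M + N).
Proof.
move=> [hM pM] [hN pN]; split; first exact: hermsymmxD.
by move=> v; rewrite -/(qform _ _) qformD addr_ge0 // ?pM ?pN.
Qed.

Lemma psdmxZ d (c : C) (M : 'M[C]_d) : 0 <= c -> psdmx M -> psdmx (c *: M).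
Proof.
move=> c0 [hM pM]; split; first by rewrite hermsymmxZ // realE c0.
by move=> v; rewrite -/(qform _ _) qformZ mulr_ge0 // pM.
Qed.

Lemma qform_real d (M : 'M[C]_d) v : M \is hermsymmx -> qform M v \is Num.real.
Proof.
move=> /hermsymmxP hM; apply/CrealP; rewrite -adjmxE.
by rewrite !adjmxM trmxCK -hM mulmxA.
Qed.

(** The spectral theorem gives a unitary diagonalisation; the eigenvalues are nonnegative, so their
    square roots can be put on the diagonal and absorbed into one factor. *)
Lemma psdmx_factor d (M : 'M[C]_d) :
  psdmx M -> exists N : 'M[C]_d, M = N *m N^t*.
Proof.
move=> [hM pM].
have /orthomx_spectralP eM := hermitian_normalmx hM.
have uP := spectral_unitarymx M.
set P := spectralmx M in eM uP *; set D := spectral_diag M in eM *.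
have PP : P *m P^t* = 1%:M by apply/unitarymxP.
rewrite invmx_unitary // in eM.
have D0 i : 0 <= D 0 i.
  (* Column [i] of [P^t*] is a unit eigenvector for [D 0 i], so the quadratic form takes the value
     [D 0 i] there. *)
  have := pM (P^t* *m delta_mx i 0).
  rewrite eM adjmxM trmxCK !mulmxA -(mulmxA _ P) PP mulmx1.
  rewrite -(mulmxA _ P) PP mulmx1 trmx_delta map_delta_mx -rowE -colE.
  by rewrite !mxE eqxx mulr1n.
pose E := \row_i sqrtC (D 0 i).
exists (P^t* *m diag_mx E).
have EE : (diag_mx E)^t* = diag_mx E.
  rewrite tr_diag_mx map_diag_mx; congr diag_mx.
  apply/rowP => i; rewrite !mxE.
  by apply: conj_Creal; rewrite realE sqrtC_ge0 D0.
have DE : diag_mx D = diag_mx E *m diag_mx E.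
  rewrite mulmx_diag; congr diag_mx; apply/rowP => i; rewrite !mxE.
  by rewrite -expr2 sqrtCK.
rewrite adjmxM trmxCK EE mulmxA -(mulmxA _ (diag_mx E) (diag_mx E)) -DE; exact: eM.
Qed.

(** Transposing a Gram matrix of [N] yields the Gram matrix of the entrywise conjugate of [N]. *)
Lemma psdmx_tr d (M : 'M[C]_d) : psdmx M -> psdmx M^T.
Proof.
move=> /psdmx_factor [N ->]; rewrite trmx_mul.
have e : N^T = (N^t*^T)^t* by rewrite trmxK map_mxCK.
rewrite [X in _ *m X]e.
exact: psdmx_gram.
Qed.

Lemma psdmx_sum_ketbra d (M : 'M[C]_d) :
  psdmx M -> exists v : 'I_d -> 'cV[C]_d, M = \sum_k ketbra (v k).
Proof.
move=> /psdmx_factor [N ->]; exists (fun k => col k N).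
apply/matrixP => i j; rewrite summxE !mxE; apply: eq_bigr => k _.
by rewrite !mxE big_ord1 !mxE.
Qed.

Lemma is_state_ketbra d (v : 'cV[C]_d) :
  (v^t* *m v) 0 0 = 1 -> is_state (ketbra v).
Proof.
move=> v1; split; first exact: psdmx_ketbra.
by rewrite mxtrace_mulC trace_mx11.
Qed.

Lemma is_povm_op_ketbra d (v : 'cV[C]_d) :
  (v^t* *m v) 0 0 = 1 -> is_povm_op (ketbra v).
Proof.
move=> v1; split; first exact: psdmx_ketbra.
have vv : v^t* *m v = 1%:M by rewrite [LHS]mx11_scalar v1.
have hk := (psdmx_ketbra v).1.
have hP : 1%:M - ketbra v \is hermsymmx.
  rewrite -scaleN1r; apply: hermsymmxD.
    by apply/hermsymmxP; rewrite trmx1 map_mx1.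
  by apply: hermsymmxZ hk; rewrite rpredN rpred1.
(* The complement of an orthogonal projection is a Hermitian idempotent, hence its own Gram
   matrix. *)
have -> : 1%:M - ketbra v = (1%:M - ketbra v) *m (1%:M - ketbra v)^t*.
  rewrite -(hermsymmxP _ hP) mulmxBl mul1mx mulmxBr mulmx1.
  by rewrite /ketbra -!mulmxA (mulmxA _ v) vv mul1mx subrr subr0.
exact: psdmx_gram.
Qed.

(** Factor [M] as a column [c] times a row [r]. Cancelling [c] on the left and [r] on the right in
    [M *m M = M] leaves [r *m c = 1], and the trace is cyclic. *)
Lemma mxtrace_rank1_idem (F : fieldType) d (M : 'M[F]_d) :
  M *m M = M -> \rank M = 1%N -> \tr M = 1.
Proof.
move=> MM rM; have := mulmx_base M; have := row_base_free M.
have /row_fullP := col_base_full M.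
move: (col_base M) (row_base M); rewrite rM.
move=> c r [c' c'c] /row_freeP [r' rr'] eM.
have := MM; rewrite -eM => /(congr1 (fun X => c' *m X *m r')).
rewrite !mulmxA c'c mul1mx -!mulmxA rr' mulmx1 => rc.
by rewrite mxtrace_mulC rc mxtrace1.
Qed.

Lemma is_state_pure d (M : 'M[C]_d) : is_pure_state M -> is_state M.
Proof.
move=> [hM MM rM]; split; last exact: mxtrace_rank1_idem.
by rewrite -MM {2}(hermsymmxP _ hM); exact: psdmx_gram.
Qed.

Lemma is_state_mix d (e : R) (M N : 'M[C]_d) : 0 <= e <= 1 ->
  is_state M -> is_state N -> is_state ((1 - e)%:C *: M + e%:C *: N).
Proof.
move=> /andP[e0 e1] [pM tM] [pN tN]; split.
  by apply: psdmxD; apply: psdmxZ => //; rewrite lecR // subr_ge0.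
by rewrite mxtraceD !mxtraceZ tM tN !mulr1 -raddfD /= subrK.
Qed.

(** Subtracting from [v] its projection on [a] leaves a vector orthogonal to [a]; if no nonzero one
    exists, [v] is a multiple of [a]. The second alternative is dimension one. *)
Lemma orthogonal_or_span d (a : 'cV[C]_d) : (a^t* *m a) 0 0 = 1 ->
  (exists2 s : 'cV[C]_d, (s^t* *m s) 0 0 = 1 & qform (ketbra s) a = 0) \/
  (forall v : 'cV[C]_d, exists c, v = c *: a).
Proof.
move=> a1; have aa : a^t* *m a = 1%:M by rewrite [LHS]mx11_scalar a1.
have [h|h] := pselect (exists2 u : 'cV[C]_d, u != 0 & a^t* *m u = 0).
  left; case: h => u /unit_scaling [c _ s1] au; exists (c *: u) => //.
  rewrite /qform /ketbra !mulmxA -scalemxAr au scaler0.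
  by rewrite !mul0mx mxE.
right => v; exists ((a^t* *m v) 0 0).
apply/eqP; rewrite -subr_eq0; apply/negPn/negP => v0; apply: h.
exists (v - (a^t* *m v) 0 0 *: a) => //.
rewrite mulmxBr -scalemxAr aa scale_scalar_mx mulr1.
by rewrite -mx11_scalar subrr.
Qed.

Lemma ketbra_tens m n (a : 'cV[C]_m) (b : 'cV[C]_n) :
  ketbra (a *t b : 'cV[C]_(m * n)) = ketbra a *t ketbra b.
Proof.
have e : (a *t b : 'cV[C]_(m * n))^t* = a^t* *t b^t*.
  by apply/matrixP => i j; rewrite !mxE rmorphM.
rewrite /ketbra e; exact: (@tensmx_mul _ m 1 n 1 m n).
Qed.

Lemma tens_spanl m n (a : 'cV[C]_m) :
  (forall v : 'cV[C]_m, exists c, v = c *: a) ->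
  forall v : 'cV[C]_(m * n), exists b : 'cV[C]_n, v = a *t b.
Proof.
move=> span v.
pose col j : 'cV[C]_m := \col_i v (mxtens_index (i, j)) 0.
(* Each slice of [v] at a fixed second index is a multiple of [a]; the multipliers are the
   coordinates of the second factor. *)
have [c hc] := choice (fun j : 'I_n => span (col j)).
exists (\col_j c j); apply/matrixP => k l; case: (mxtens_indexP k) => i j.
rewrite ord1 [RHS]mxE mxtens_indexK /= !mxE.
by have /colP/(_ i) := hc j; rewrite !mxE mulrC [X in a _ X]ord1.
Qed.

Lemma tens_spanr m n (b : 'cV[C]_n) :
  (forall v : 'cV[C]_n, exists c, v = c *: b) ->
  forall v : 'cV[C]_(m * n), exists a : 'cV[C]_m, v = a *t b.
Proof.
move=> span v.
pose row i : 'cV[C]_n := \col_j v (mxtens_index (i, j)) 0.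
have [c hc] := choice (fun i : 'I_m => span (row i)).
exists (\col_i c i); apply/matrixP => k l; case: (mxtens_indexP k) => i j.
rewrite ord1 [RHS]mxE mxtens_indexK /= !mxE.
by have /colP/(_ j) := hc i; rewrite !mxE [X in b _ X]ord1.
Qed.

Lemma mxtrace_tens m n (A : 'M[C]_m) (B : 'M[C]_n) :
  \tr (A *t B) = \tr A * \tr B.
Proof.
rewrite /mxtrace mulr_sum; apply: eq_bigr => k _.
by rewrite !mxE.
Qed.

Lemma tensmxZ m n p q c d (A : 'M[C]_(m, n)) (B : 'M[C]_(p, q)) :
  (c *: A) *t (d *: B) = (c * d) *: (A *t B).
Proof. by apply/matrixP => i j; rewrite !mxE mulrACA. Qed.

Lemma tensmx_sum (I J : finType) m n p q
    (A : I -> 'M[C]_(m, n)) (B : J -> 'M[C]_(p, q)) :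
  (\sum_i A i) *t (\sum_j B j) = \sum_i \sum_j A i *t B j.
Proof.
apply/matrixP => k l; rewrite !mxE !summxE mulr_suml; apply: eq_bigr => i _.
by rewrite mulr_sumr summxE; apply: eq_bigr => j _; rewrite mxE.
Qed.

Lemma psdmx_tens m n (A : 'M[C]_m) (B : 'M[C]_n) :
  psdmx A -> psdmx B -> psdmx (A *t B).
Proof.
move=> /psdmx_factor [M ->] /psdmx_factor [N ->].
rewrite -tensmx_mul -map_mxT -trmx_tens; exact: psdmx_gram.
Qed.

Lemma psdmx_trace_mul_ge0 d (M N : 'M[C]_d) :
  psdmx M -> psdmx N -> 0 <= \tr (M *m N).
Proof.
move=> [_ pM] /psdmx_sum_ketbra [v ->].
rewrite mulmx_sumr raddf_sum sumr_ge0 // => k _.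
by rewrite /= tr_mul_ketbra pM.
Qed.

Lemma qform_scale d (M : 'M[C]_d) c v :
  qform M (c *: v) = `|c| ^+ 2 * qform M v.
Proof.
by rewrite /qform adjmxZ -!scalemxAl -scalemxAr scalerA mxE -normCKC.
Qed.

Lemma ketbra_scale d c (v : 'cV[C]_d) : ketbra (c *: v) = `|c| ^+ 2 *: ketbra v.
Proof. by rewrite /ketbra adjmxZ -scalemxAl -scalemxAr scalerA normCK. Qed.

Lemma ketbra0 d : ketbra (0 : 'cV[C]_d) = 0.
Proof. exact: mul0mx. Qed.

Lemma tr_ketbra d (v : 'cV[C]_d) : (ketbra v)^T = ketbra (map_mx Num.conj v).
Proof.
by apply/matrixP => i j; rewrite !mxE !big_ord1 !mxE conjCK mulrC.
Qed.

(** The order on [C] is partial, so failing to be nonnegative does not by itself mean being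
    negative; it does here because a Hermitian form takes real values. *)
Lemma not_psdmx d (M : 'M[C]_d) : M \is hermsymmx -> ~ psdmx M ->
  exists2 v : 'cV[C]_d, (v^t* *m v) 0 0 = 1 & qform M v < 0.
Proof.
move=> hM nM.
have [[v nv]|h] := pselect (exists v, ~ 0 <= qform M v); last first.
  case: nM; split=> // v; apply: contrapT => nv; apply: h; by exists v.
have v0 : v != 0.
  by apply: contra_notN nv => /eqP ->; rewrite /qform mulmx0 mxE.
have [c c0 c1] := unit_scaling v0; exists (c *: v) => //.
rewrite qform_scale pmulr_rlt0; last by rewrite exprn_gt0 // normr_gt0 gt_eqF.
by rewrite real_ltNge ?qform_real ?real0 //; apply/negP.
Qed.

End PositiveMatrices.

(** * Making a zero-sum matrix negative by shrinking rows and columns *)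

Lemma zero_sum_gt0 (F : realFieldType) (I : finType) (h : I -> F) i0 :
  \sum_i h i = 0 -> h i0 != 0 -> exists i, 0 < h i.
Proof.
move=> s0 hi0; apply: contrapT => nex.
have h_le0 i : h i <= 0.
  by rewrite leNgt; apply/negP => hi; apply: nex; exists i.
have s0' : \sum_i - h i = 0 by rewrite sumrN s0 oppr0.
have /eqP : - h i0 = 0.
  by apply: (psumr_eq0P _ s0') => // i _; rewrite oppr_ge0.
by rewrite oppr_eq0 (negbTE hi0).
Qed.

Lemma sum_shrink1 (F : realFieldType) (I : finType) (e : F) (h : I -> F) i0 :
  \sum_i (1 - e * (i == i0)%:R) * h i = \sum_i h i - e * h i0.
Proof.
rewrite [in RHS](bigD1 i0) //= (bigD1 i0) //= eqxx mulr1.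
rewrite (eq_bigr h) => [|i /negbTE ->]; last by rewrite mulr0 subr0 mul1r.
by rewrite mulrBl mul1r addrAC.
Qed.

(* If every row and column sums to zero, shrinking the row and the column of a
   negative entry [k x y] changes the total by [e ^+ 2 * k x y]. *)
Lemma zero_sum_shrink (F : realFieldType) (X Y : finType) (e : F)
    (k : X -> Y -> F) x0 y0 :
  0 < e -> \sum_x \sum_y k x y = 0 -> k x0 y0 != 0 ->
  exists (S : pred X) (T : pred Y),
    \sum_x \sum_y (1 - e * (S x)%:R) * ((1 - e * (T y)%:R) * k x y) < 0.
Proof.
move=> e0 k0 kxy.
pose r x := \sum_y k x y; pose c y := \sum_x k x y.
have c0 : \sum_y c y = 0 by rewrite exchange_big.
(* If the row sums are not all zero, one of them is positive because they add up to zero; shrinking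
   that row alone suffices. Columns are treated alike. *)
have [[x rx]|nr] := pselect (exists x, r x != 0).
  have [x1 rx1] := zero_sum_gt0 k0 rx.
  exists (pred1 x1), pred0.
  under eq_bigr => x' _ do under eq_bigr => y _ do rewrite mulr0 subr0 mul1r.
  under eq_bigr do rewrite -mulr_sumr.
  by rewrite sum_shrink1 k0 sub0r oppr_lt0 mulr_gt0.
have [[y cy]|nc] := pselect (exists y, c y != 0).
  have [y1 cy1] := zero_sum_gt0 c0 cy.
  exists pred0, (pred1 y1); rewrite exchange_big.
  under eq_bigr => y' _ do under eq_bigr => x _ do rewrite mulr0 subr0 mul1r.
  under eq_bigr do rewrite -mulr_sumr.
  by rewrite sum_shrink1 c0 sub0r oppr_lt0 mulr_gt0.
have r0 x : r x = 0 by apply: contra_notP nr => /eqP rx; exists x.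
have cc0 y : c y = 0 by apply: contra_notP nc => /eqP cy; exists y.
(* Row [x0] sums to zero and has a nonzero entry, so its negation has a positive entry, which
   locates a negative [k x0 y1]. *)
have Nr0 : \sum_y - k x0 y = 0 by rewrite sumrN -/(r x0) r0 oppr0.
have [|y1] := zero_sum_gt0 (i0 := y0) Nr0; first by rewrite oppr_eq0.
rewrite oppr_gt0 => ky1; exists (pred1 x0), (pred1 y1).
under eq_bigr do rewrite -mulr_sumr sum_shrink1.
rewrite sum_shrink1 sumrB k0 -mulr_sumr -/(c y1) cc0 -/(r x0) r0.
by rewrite mulr0 !sub0r oppr0 mulrN opprK add0r !pmulr_rlt0.
Qed.

(** * Weakly optimal witnesses on product vectors *)

Section Witness.
Context {R : realType} {m n : nat} {W : 'M[R[i]]_(m * n)}.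
Local Notation C := R[i].
Hypothesis Wopt : weakly_optimal_ew W.

Lemma ew_state_ge0 (A : 'M[C]_m) (B : 'M[C]_n) :
  is_state A -> is_state B -> 0 <= \tr (W *m (A *t B)).
Proof.
move=> sA sB; have [_ _ h _] := Wopt; apply: h.
exists 1%N, (fun=> 1), (fun=> A), (fun=> B); split=> //.
- by rewrite big_ord1.
- by rewrite big_ord1 scale1r.
Qed.

Lemma ew_ketbra_ge0 (v : 'cV[C]_m) (w : 'cV[C]_n) :
  0 <= \tr (W *m (ketbra v *t ketbra w)).
Proof.
have [->|/unit_scaling [c c0 /is_state_ketbra sv]] := eqVneq v 0.
  by rewrite ketbra0 tens0mx mulmx0 mxtrace0.
have [->|/unit_scaling [d d0 /is_state_ketbra sw]] := eqVneq w 0.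
  by rewrite ketbra0 tensmx0 mulmx0 mxtrace0.
have := ew_state_ge0 sv sw.
rewrite !ketbra_scale tensmxZ -scalemxAr mxtraceZ pmulr_rge0 //.
by rewrite mulr_gt0 // exprn_gt0 // normr_gt0 gt_eqF.
Qed.

(** At a separable minimiser the trace is a combination of nonnegative terms with total zero, so
    each term of nonzero weight vanishes. Splitting the two states of such a term into rank-one
    pieces repeats the argument. *)
Lemma ew_product_zero : exists (v : 'cV[C]_m) (w : 'cV[C]_n),
  [/\ (v^t* *m v) 0 0 = 1, (w^t* *m w) 0 0 = 1
    & \tr (W *m (ketbra v *t ketbra w)) = 0].
Proof.
have [_ [_ [k [p [A [B [p0 p1 sA sB ->]]]]] tr0] _ _] := Wopt.
have [j pj] : exists j, p j != 0.
  apply: contrapT => nex.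
  have : \sum_j p j = 0.
    by apply: big1 => j _; apply: contra_notP nex => /eqP; exists j.
  by rewrite p1 => /eqP; rewrite oner_eq0.
have {tr0} trj : \tr (W *m (A j *t B j)) = 0.
  move: tr0; rewrite mulmx_sumr raddf_sum /=.
  under eq_bigr do rewrite -scalemxAr mxtraceZ.
  move=> /psumr_eq0P h.
  have /eqP : (p j)%:C * \tr (W *m (A j *t B j)) = 0.
    by apply: h => // i _; rewrite mulr_ge0 ?ew_state_ge0 // lecR.
  by rewrite mulf_eq0 fmorph_eq0 (negbTE pj) => /eqP.
have [/psdmx_sum_ketbra [v eA] tA] := sA j.
have [/psdmx_sum_ketbra [w eB] tB] := sB j.
(* Trace one forbids all vectors of the decomposition from being zero, so one can be normalised. *)
have nz d (u : 'I_d -> 'cV[C]_d) : \tr (\sum_i ketbra (u i)) = 1 ->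
    exists i, u i != 0.
  move=> tu; apply: contrapT => nex; move: tu; rewrite big1 => [|i _].
    by rewrite mxtrace0 => /esym/eqP; rewrite oner_eq0.
  have [->|ui] := eqVneq (u i) 0; first exact: ketbra0.
  by case: nex; exists i.
rewrite eA in tA; rewrite eB in tB.
have [a va] := nz _ _ tA; have [b wb] := nz _ _ tB.
have tab : \tr (W *m (ketbra (v a) *t ketbra (w b))) = 0.
  move: trj; rewrite eA eB tensmx_sum mulmx_sumr raddf_sum /=.
  under eq_bigr do rewrite mulmx_sumr raddf_sum /=.
  move=> /psumr_eq0P h.
  have /psumr_eq0P : \sum_j0 \tr (W *m (ketbra (v a) *t ketbra (w j0))) = 0.
    by apply: h => // i _; apply: sumr_ge0 => l _; exact: ew_ketbra_ge0.
  by apply => // l _; exact: ew_ketbra_ge0.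
have [c c0 vc] := unit_scaling va; have [d d0 wd] := unit_scaling wb.
exists (c *: v a), (d *: w b); split; [exact: vc|exact: wd|].
by rewrite !ketbra_scale tensmxZ -scalemxAr mxtraceZ tab mulr0.
Qed.

(** If all vectors were products, every state would be a sum of product projectors up to scale, and
    the witness could detect nothing. This excludes a one-dimensional factor. *)
Lemma ew_entangled_vector :
  ~ (forall u : 'cV[C]_(m * n),
       exists (v : 'cV[C]_m) (w : 'cV[C]_n), u = v *t w).
Proof.
move=> h; have [_ _ _ [rho [[/psdmx_sum_ketbra [u ->] _] _]]] := Wopt.
rewrite mulmx_sumr raddf_sum /= => /lt_geF/negP; apply.
apply: sumr_ge0 => k _; have [v [w ->]] := h (u k).
by rewrite ketbra_tens; exact: ew_ketbra_ge0.
Qed.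

End Witness.

(** * Traces of [mdi_operator] and fidelities of noisy inputs *)

Section Sensitivity.
Context {R : realType} {m n : nat}.
Local Notation C := R[i].

Lemma mdi_operator_trace (X Y : finType) (beta : X -> Y -> R)
    (tau : X -> 'M[C]_m) (omega : Y -> 'M[C]_n) (A : 'M[C]_m) (B : 'M[C]_n) :
  \tr (mdi_operator beta tau omega *m (A^T *t B^T)) =
  \sum_x \sum_y (beta x y)%:C * \tr (A *m tau x) * \tr (B *m omega y).
Proof.
rewrite mulmx_suml raddf_sum; apply: eq_bigr => x _.
rewrite mulmx_suml raddf_sum; apply: eq_bigr => y _ /=.
rewrite -scalemxAl mxtraceZ tensmx_mul mxtrace_tens -!trmx_mul !mxtrace_tr.
by rewrite mulrA.
Qed.

Lemma mdi_operator_rows (X Y : finType) (beta : X -> Y -> R)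
    (tau : X -> 'M[C]_m) (omega : Y -> 'M[C]_n) :
  mdi_operator beta tau omega =
  \sum_x (tau x)^T *t (\sum_y (beta x y)%:C *: omega y)^T.
Proof.
apply: eq_bigr => x _; apply/matrixP => i j.
rewrite summxE !mxE summxE mulr_sumr; apply: eq_bigr => y _.
by rewrite !mxE mulrCA.
Qed.

Lemma mdi_operator_cols (X Y : finType) (beta : X -> Y -> R)
    (tau : X -> 'M[C]_m) (omega : Y -> 'M[C]_n) :
  mdi_operator beta tau omega =
  \sum_y (\sum_x (beta x y)%:C *: tau x)^T *t (omega y)^T.
Proof.
rewrite /mdi_operator exchange_big; apply: eq_bigr => y _; apply/matrixP => i j.
rewrite summxE !mxE summxE mulr_suml; apply: eq_bigr => x _.
by rewrite !mxE mulrA.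
Qed.

(** Meant for the groupings of the witness by rows and by columns: were all row operators, or all
    column operators, positive semidefinite, no state could have a negative expectation. *)
Lemma psdmx_sum_tens (I : finType) (A : I -> 'M[C]_m) (B : I -> 'M[C]_n) rho :
  (forall i, psdmx (A i)) -> (forall i, psdmx (B i)) -> psdmx rho ->
  0 <= \tr ((\sum_i (A i)^T *t (B i)^T) *m rho).
Proof.
move=> pA pB prho; rewrite mulmx_suml raddf_sum sumr_ge0 // => i _ /=.
by apply: psdmx_trace_mul_ge0 prho; apply: psdmx_tens; exact: psdmx_tr.
Qed.

Lemma hermsymmx_sum_real d (I : finType) (c : I -> R) (M : I -> 'M[C]_d) :
  (forall i, M i \is hermsymmx) -> \sum_i (c i)%:C *: M i \is hermsymmx.
Proof.
move=> hM; elim/big_rec: _ => [|i N _ hN].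
  by apply/hermsymmxP; rewrite trmx0 map_mx0.
by rewrite hermsymmxD ?hermsymmxZ // complex_real.
Qed.

Lemma pure_fidelity d (M : 'M[C]_d) (e : R) : 0 <= e -> is_pure_state M ->
  (1 - e)%:C <= \tr (M *m M).
Proof.
move=> e0 pM; have [_ MM _] := pM; have [_ tM] := is_state_pure pM.
by rewrite MM tM lecR gerBl.
Qed.

(** The pure part contributes exactly [1 - e], and the admixture a nonnegative amount. *)
Lemma mix_fidelity d (M N : 'M[C]_d) (e : R) : 0 <= e -> is_pure_state M ->
  psdmx N -> (1 - e)%:C <= \tr (((1 - e)%:C *: M + e%:C *: N) *m M).
Proof.
move=> e0 pM pN; have [_ MM _] := pM; have [psM tM] := is_state_pure pM.
rewrite mulmxDl -!scalemxAl mxtraceD !mxtraceZ MM tM mulr1 lerDl.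
by rewrite mulr_ge0 ?lecR // psdmx_trace_mul_ge0.
Qed.

End Sensitivity.

(** * Sensitivity: the degenerate case and the general one *)

Lemma sensitive_swap (R : realType) (X Y : finType) m n (beta : X -> Y -> R)
    (tau : X -> 'M[R[i]]_m) (omega : Y -> 'M[R[i]]_n) :
  sensitive (fun y x => beta x y) omega tau -> sensitive beta tau omega.
Proof.
move=> s e he; have [om [ta [B [A [h1 h2 h3 h4 h5]]]]] := s e he.
exists ta, om, A, B; split => //.
rewrite exchange_big; under eq_bigr do under eq_bigr do rewrite mulrAC.
exact: h5.
Qed.

(** As [a] is invisible to all ideal inputs, mixing it into the input [x0] alone selects that row,
    and the sum becomes [e] times the negative expectation of its row operator. *)
Lemma sensitive_of_row (R : realType) (X Y : finType) m n (beta : X -> Y -> R)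
    (tau : X -> 'M[R[i]]_m) (omega : Y -> 'M[R[i]]_n)
    (a : 'cV[R[i]]_m) (v : 'cV[R[i]]_n) x0 :
  (forall x, is_pure_state (tau x)) -> (forall y, is_pure_state (omega y)) ->
  (a^t* *m a) 0 0 = 1 -> (v^t* *m v) 0 0 = 1 ->
  (forall x, qform (tau x) a = 0) ->
  qform (\sum_y (beta x0 y)%:C *: omega y) v < 0 ->
  sensitive beta tau omega.
Proof.
move=> ptau pomega a1 v1 tau0 neg e /andP[e0 e1].
have sa := is_state_ketbra a1; have sv := is_state_ketbra v1.
pose tau' x :=
  if x == x0 then (1 - e)%:C *: tau x + e%:C *: ketbra a else tau x.
exists tau', omega, (ketbra a), (ketbra v); split.
- move=> x; rewrite /tau'; case: eqP => _; split.
  + by apply: is_state_mix => //; [rewrite (ltW e0)|exact: is_state_pure].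
  + by apply: mix_fidelity => //; [exact: ltW|exact: psdmx_ketbra].
  + exact: is_state_pure.
  + by apply: pure_fidelity => //; exact: ltW.
- move=> y; split; first exact: is_state_pure.
  by apply: pure_fidelity => //; exact: ltW.
- exact: is_povm_op_ketbra.
- exact: is_povm_op_ketbra.
have aa : \tr (ketbra a *m ketbra a) = 1.
  rewrite tr_mul_ketbra /qform !mulmxA -mulmxA.
  by rewrite [_^t* *m a]mx11_scalar a1 mulmx1 mxE.
have ftau' x : \tr (ketbra a *m tau' x) = if x == x0 then e%:C else 0.
  rewrite /tau'; case: eqP => _; last by rewrite tr_ketbra_mul.
  rewrite mulmxDr -!scalemxAr mxtraceD !mxtraceZ aa tr_ketbra_mul tau0.
  by rewrite mulr0 add0r mulr1.
rewrite (bigD1 x0) //= [X in _ + X]big1 ?addr0 => [|x /negbTE xx0]; last first.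
  by apply: big1 => y _; rewrite ftau' xx0 mulr0 mul0r.
rewrite (_ : \sum_y _ = e%:C * qform (\sum_y (beta x0 y)%:C *: omega y) v).
  by rewrite pmulr_rlt0 // ltcR.
rewrite -tr_ketbra_mul mulmx_sumr raddf_sum mulr_sumr; apply: eq_bigr => y _ /=.
by rewrite ftau' eqxx -scalemxAr mxtraceZ mulrAC mulrC.
Qed.

Theorem corollary4 (R : realType) (X Y : finType) (m n : nat)
    (beta : X -> Y -> R) (tau : X -> 'M[R[i]]_m) (omega : Y -> 'M[R[i]]_n)
    (Hew : is_mdi_ew beta tau omega)
    (Hbeta : forall (x : X) (y : Y), beta x y != 0) :
  sensitive beta tau omega.
Proof.
have [_ ptau pomega Wopt] := Hew.
have [a0 [b0 [a01 b01]]] := ew_product_zero Wopt.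
have unit_conj d (v : 'cV[R[i]]_d) : (v^t* *m v) 0 0 = 1 ->
    ((map_mx Num.conj v)^t* *m map_mx Num.conj v) 0 0 = 1.
  rewrite map_trmx map_mxCK => <-; rewrite !mxE.
  by apply: eq_bigr => i _; rewrite !mxE mulrC.
pose a := map_mx Num.conj a0; pose b := map_mx Num.conj b0.
have a1 : (a^t* *m a) 0 0 = 1 by exact: unit_conj.
have b1 : (b^t* *m b) 0 0 = 1 by exact: unit_conj.
(* Conjugating the vectors produces the transposes that [mdi_operator_trace] expects. *)
have -> : ketbra a0 = (ketbra a)^T by rewrite tr_ketbra map_mxCK.
have -> : ketbra b0 = (ketbra b)^T by rewrite tr_ketbra map_mxCK.
rewrite mdi_operator_trace => S0.
have [_ _ _ [rho [[prho _] _] neg]] := Wopt.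
have rows : exists x, ~ psdmx (\sum_y (beta x y)%:C *: omega y).
  apply/existsNP => h; move: neg => /lt_geF/negP; apply.
  rewrite mdi_operator_rows.
  by apply: psdmx_sum_tens => // x; have [] := is_state_pure (ptau x).
have cols : exists y, ~ psdmx (\sum_x (beta x y)%:C *: tau x).
  apply/existsNP => h; move: neg => /lt_geF/negP; apply.
  rewrite mdi_operator_cols.
  by apply: psdmx_sum_tens => // y; have [] := is_state_pure (pomega y).
have [[x0 fx0]|f0] := pselect (exists x, qform (tau x) a != 0); last first.
  have [x0 /not_psdmx [|v v1 vneg]] := rows.
    by apply: hermsymmx_sum_real => y; have [] := pomega y.
  apply: (sensitive_of_row ptau pomega a1 v1 _ vneg) => x.
  by apply: contra_notP f0 => /eqP; exists x.
have [[y0 gy0]|g0] := pselect (exists y, qform (omega y) b != 0); last first.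
  have [y0 /not_psdmx [|v v1 vneg]] := cols.
    by apply: hermsymmx_sum_real => x; have [] := ptau x.
  apply: sensitive_swap.
  apply: (sensitive_of_row (beta := fun y x => beta x y) pomega ptau b1 v1
            _ vneg) => y.
  by apply: contra_notP g0 => /eqP; exists y.
(* If [a] spanned its space, every vector of the tensor product would be a product vector,
   contradicting [ew_entangled_vector]. So a unit [s] orthogonal to [a] is available as noise. *)
have [[s s1 sa]|spa] := orthogonal_or_span a1; last first.
  case: (ew_entangled_vector Wopt) => u.
  by have [w ->] := tens_spanl spa u; exists a, w.
have [[t t1 tb]|spb] := orthogonal_or_span b1; last first.
  case: (ew_entangled_vector Wopt) => u.
  by have [w ->] := tens_spanr spb u; exists w, b.
move=> e /andP[e0 e1].
(* These expectations are real, so nothing is lost by moving to [R], whose total order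
   [zero_sum_shrink] requires. *)
pose f x := complex.Re (qform (tau x) a).
pose g y := complex.Re (qform (omega y) b).
have fE x : \tr (ketbra a *m tau x) = (f x)%:C.
  rewrite tr_ketbra_mul RRe_real //; apply: qform_real.
  by have [] := ptau x.
have gE y : \tr (ketbra b *m omega y) = (g y)%:C.
  rewrite tr_ketbra_mul RRe_real //; apply: qform_real.
  by have [] := pomega y.
pose k x y := beta x y * f x * g y.
have k0 : \sum_x \sum_y k x y = 0.
  apply: (@complexI R); rewrite -[RHS]S0 rmorph_sum; apply: eq_bigr => x _ /=.
  rewrite rmorph_sum; apply: eq_bigr => y _ /=.
  by rewrite fE gE !rmorphM.
(* Here the nonvanishing of [beta] enters: [x0] and [y0] were chosen independently. *)
have kxy : k x0 y0 != 0.
  rewrite !mulf_neq0 ?Hbeta //.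
    by rewrite -(fmorph_eq0 (real_complex R)) /= -fE tr_ketbra_mul.
  by rewrite -(fmorph_eq0 (real_complex R)) /= -gE tr_ketbra_mul.
have [S [T neg']] := zero_sum_shrink e0 k0 kxy.
pose tau' x := if S x then (1 - e)%:C *: tau x + e%:C *: ketbra s else tau x.
pose omega' y :=
  if T y then (1 - e)%:C *: omega y + e%:C *: ketbra t else omega y.
exists tau', omega', (ketbra a), (ketbra b); split.
- move=> x; rewrite /tau'; case: (S x); split.
  + by apply: is_state_mix; rewrite ?(ltW e0) //;
      [exact: is_state_pure|exact: is_state_ketbra].
  + by apply: mix_fidelity => //; [exact: ltW|exact: psdmx_ketbra].
  + exact: is_state_pure.
  + by apply: pure_fidelity => //; exact: ltW.
- move=> y; rewrite /omega'; case: (T y); split.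
  + by apply: is_state_mix; rewrite ?(ltW e0) //;
      [exact: is_state_pure|exact: is_state_ketbra].
  + by apply: mix_fidelity => //; [exact: ltW|exact: psdmx_ketbra].
  + exact: is_state_pure.
  + by apply: pure_fidelity => //; exact: ltW.
- exact: is_povm_op_ketbra.
- exact: is_povm_op_ketbra.
(* The noise [ketbra s] has zero expectation under [ketbra a], so mixing only rescales [f x] by
   [1 - e] on [S]. *)
have ftau' x : \tr (ketbra a *m tau' x) = ((1 - e * (S x)%:R) * f x)%:C.
  rewrite /tau'; case: (S x); last by rewrite mulr0 subr0 mul1r.
  rewrite mulmxDr -!scalemxAr mxtraceD !mxtraceZ fE.
  by rewrite (tr_ketbra_mul (ketbra s)) sa mulr0 addr0 mulr1 rmorphM.
have gomega' y : \tr (ketbra b *m omega' y) = ((1 - e * (T y)%:R) * g y)%:C.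
  rewrite /omega'; case: (T y); last by rewrite mulr0 subr0 mul1r.
  rewrite mulmxDr -!scalemxAr mxtraceD !mxtraceZ gE.
  by rewrite (tr_ketbra_mul (ketbra t)) tb mulr0 addr0 mulr1 rmorphM.
move: neg'; rewrite -ltcR rmorph0; congr (_ < _); rewrite rmorph_sum.
apply: eq_bigr => x _; rewrite rmorph_sum; apply: eq_bigr => y _ /=.
rewrite ftau' gomega' -!rmorphM; congr (_ %:C); rewrite /k.
by ring.
Qed.
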